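(* Let $n$ and $k$ be positive integers and let $m=n^k$. Then there is a set $M$ with $|M|=m$ and a function $f:\binom{M}{k}\to\binom{M}{k!}$ such that $X\cap f(X)=\emptyset$ for all $X\in\binom{M}{k}$, and every $P\subset M$ with $|P|>k^2n$ contains a $k$-element set $X\subset P$ such that $f(X)\cap P\neq\emptyset$.
   Context: For a set $M$ and an integer $j$, $\binom{M}{j}$ denotes the family of all $j$-element subsets of $M$.
   Formalization: The formal statement adds the assumption that n^k < k or n^k ≥ k + k!; in the excluded cases (e.g. n = k = 1, or n = 2, k = 3) k-element sets X exist but no k!-element subset of M is disjoint from X, so no such f exists. *)

(* Defs.v *)
From mathcomp Require Import all_boot.
Set Implicit Arguments.
Unset Strict Implicit.
Unset Printing Implicit Defensive.

Definition ksubset (M : finType) (j : nat) := {X : {set M} | #|X| == j}.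

(* A map f with X and f X always disjoint exists only if M has no k-element   *)
(* subset, or the complement of a k-element subset has room for k! elements.  *)
(* This fails for #|M| = n ^ k when, e.g., (n, k) = (1, 1) or (2, 3), so the  *)
(* size condition has to be a hypothesis.                                     *)
Lemma disjoint_map_room (M : finType) (k : nat)
    (f : ksubset M k -> ksubset M k`!) :
  (forall X, val X :&: val (f X) = set0) -> #|M| < k \/ k + k`! <= #|M|.
Proof.
move=> fD; have [|leKM] := ltnP #|M| k; [by left | right].
have [A /andP[_ /eqP cA]] :
    exists A : {set M}, (A \subset [set: M]) && (#|A| == k).
  by apply/card_gt0P; rewrite -cardsE cards_draws cardsT bin_gt0.
pose X : ksubset M k := Sub A (introT eqP cA).
rewrite -{1}(eqP (valP X)) -(eqP (valP (f X))).
by rewrite -cardsUI fD cards0 addn0 max_card.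
Qed.

(* Main.v *)
(** Take M = [n]^k.  Let f X contain every point outside X of the form
    (x_1(1), ..., x_k(k)) with x_1, ..., x_k an ordering of X; there are at most
    k! of them.  If P has more than k^2 n points, discard from P every
    coordinate hyperplane section with at most k points: there are k n
    hyperplanes, so some y in P survives, and the k sections of P through y have
    k points each besides y.  Greedily choosing distinct x_i <> y with
    x_i(i) = y(i) gives a k-set X in P with y in f X. *)
Require Import Defs.
From mathcomp Require Import all_boot.

(** Greedy choice: when a new index [i] is reached, fewer than [#|A i|] values are taken. [x0] is
    the default value off [s]. *)
Lemma distinct_representatives (I : eqType) (T : finType) (A : I -> {set T})
    (x0 : T) (s : seq I) :
    (forall i, size s <= #|A i|) ->
  exists g : I -> T,
    {in s &, injective g} /\ {in s, forall i, g i \in A i}.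
Proof.
elim: s => [|i s IHs] leA; first by exists (fun=> x0).
have [g [g_inj gA]] := IHs (fun j => ltnW (leA j)).
have [s_i | s'i] := boolP (i \in s).
  (* [s] may contain repetitions; a repeated index already has its representative. *)
  have sub : {subset i :: s <= s} by move=> j /[1!inE] /predU1P[->|].
  by exists g; split; [apply: sub_in2 g_inj | apply: sub_in1 gA].
have /card_gt0P[x] : 0 < #|A i :\: [set x in map g s]|.
  rewrite cardsD subn_gt0 (leq_trans _ (leA i)) // ltnS.
  rewrite (leq_trans (subset_leq_card (subsetIr _ _))) // cardsE.
  by rewrite (leq_trans (card_size _)) ?size_map.
rewrite !inE => /andP[g'x Ax].
have gx j : j \in s -> g j != x.
  by move=> s_j; apply: contraNneq g'x => <-; apply: map_f.
have neq_i j : j \in s -> (j == i) = false.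
  by move=> s_j; apply: contraNF s'i => /eqP <-.
exists [eta g with i |-> x]; split=> [j l|j]; rewrite !inE /=.
  case/predU1P=> [-> | s_j] /predU1P[-> | s_l]; rewrite ?eqxx ?neq_i //.
  - by move=> e; move: (gx _ s_l); rewrite -e eqxx.
  - by move=> e; move: (gx _ s_j); rewrite -e eqxx.
  - exact: g_inj.
by case/predU1P=> [-> | s_j]; rewrite ?eqxx ?neq_i // gA.
Qed.

(** There are [#|I| * #|C|] fibers, so those with at most [b] points cannot cover [P]; a point
    outside their union has only large fibers. *)
Lemma exists_all_fibers_large (I C T : finType) (c : I -> T -> C) (b : nat)
    (P : {set T}) :
    #|I| * #|C| * b < #|P| ->
  exists2 y, y \in P & forall i, b < #|[set x in P | c i x == c i y]|.
Proof.
pose fiber (p : I * C) := [set x in P | c p.1 x == p.2].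
pose small := \bigcup_(p | #|fiber p| <= b) fiber p.
have le_small : #|small| <= #|I| * #|C| * b.
  rewrite -card_prod -sum_nat_const.
  apply: leq_trans (_ : \sum_(p | #|fiber p| <= b) #|fiber p| <= _).
    apply: (big_rec2 (fun (A : {set T}) m => #|A| <= m)) => [|p m A _ leA].
      by rewrite cards0.
    by rewrite (leq_trans (leq_card_setU _ _)) // leq_add2l.
  by rewrite big_mkcond; apply: leq_sum => p _; case: ifP.
move=> ltP; have /subsetPn[y Py small'y] : ~~ (P \subset small).
  by apply: contraTN ltP => /subset_leq_card leP; rewrite -leqNgt (leq_trans leP).
exists y => // i; rewrite ltnNge; apply: contra small'y => le_b.
by apply/bigcupP; exists (i, c i y); rewrite // inE Py eqxx.
Qed.

Lemma subset_between (T : finType) (A B : {set T}) (j : nat) :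
    A \subset B -> #|A| <= j <= #|B| ->
  exists Z : {set T}, [/\ A \subset Z, Z \subset B & #|Z| = j].
Proof.
move=> sAB /andP[leAj lejB].
have [D /andP[sDBA /eqP cD]] :
    exists D : {set T}, (D \subset B :\: A) && (#|D| == j - #|A|).
  apply/card_gt0P; rewrite -cardsE cards_draws bin_gt0 cardsD.
  by rewrite (setIidPr sAB) leq_sub2r.
have [sDB dDA] := subsetDP sDBA.
exists (A :|: D); rewrite subsetUl subUset sAB sDB; split=> //.
by rewrite cardsU disjoint_setI0 1?disjoint_sym // cards0 subn0 cD subnKC.
Qed.

Definition diagonals {k : nat} {C : finType} (X : {set {ffun 'I_k -> C}}) :
    {set {ffun 'I_k -> C}} :=
  [set [ffun i => (g i : {ffun 'I_k -> C}) i]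
     | g : {ffun 'I_k -> {ffun 'I_k -> C}} in [pred g in ffun_on X | injectiveb g]].

Lemma card_diagonals (k : nat) (C : finType) (X : {set {ffun 'I_k -> C}}) :
  #|X| = k -> #|diagonals X| <= k`!.
Proof.
move=> cX; rewrite (leq_trans (leq_imset_card _ _)) //.
by rewrite -cardsE card_inj_ffuns_on cX card_ord ffactnn.
Qed.

Theorem theorem2p1 (n k : nat) (n_gt0 : 0 < n) (k_gt0 : 0 < k)
    (k_room : n ^ k < k \/ k + k`! <= n ^ k) :
  exists (M : finType) (f : ksubset M k -> ksubset M k`!),
    [/\ #|M| = n ^ k,
        forall X : ksubset M k, val X :&: val (f X) = set0
      & forall P : {set M}, k ^ 2 * n < #|P| ->
          exists X : ksubset M k,
            val X \subset P /\ val (f X) :&: P <> set0].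
Proof.
pose M : finType := {ffun 'I_k -> 'I_n}.
have cM : #|M| = n ^ k by rewrite card_ffun !card_ord.
(* The diagonals outside [X] may number fewer than [k!], so they are padded to exactly [k!] points
   within the complement of [X]. *)
have /fin_all_exists[f fP] (X : ksubset M k) : exists Z : ksubset M k`!,
    (diagonals (val X) :\: val X \subset val Z) /\ (val Z \subset ~: val X).
  have cX := eqP (valP X).
  have [||Z [sDZ sZX cZ]] :=
      @subset_between _ (diagonals (val X) :\: val X) (~: val X) k`!.
  - by rewrite setDE subsetIr.
  - rewrite (leq_trans (subset_leq_card (subsetDl _ _))) ?card_diagonals //=.
    (* If [n ^ k < k], there is no [X] to consider; otherwise the complement has at least [k!]
       points. *)
    rewrite cardsCs setCK cX cM; case: k_room => [ltMk | leM].
      by move: (max_card (mem (val X))); rewrite cX cM leqNgt ltMk.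
    by rewrite leq_subRL // (leq_trans _ leM) ?leq_addr.
  by exists (Sub Z (introT eqP cZ)).
exists M, f; split=> // [X | P ltP].
  have [_] := fP X; rewrite -disjoints_subset disjoint_sym.
  by move/disjoint_setI0.
(* Fibers with strictly more than [k] points still have [k] after [y] is removed, enough for [k]
   distinct representatives. *)
have [|y Py ltk] := @exists_all_fibers_large 'I_k 'I_n M (fun i x => x i) k P.
  by rewrite !card_ord mulnAC mulnn.
have [|g [g_inj gA]] := @distinct_representatives 'I_k M
    (fun i => [set x in P | x i == y i] :\ y) y (enum 'I_k).
  move=> i; rewrite size_enum_ord -ltnS (leq_trans (ltk i)) //.
  by rewrite (cardsD1 y) inE Py eqxx.
have {}gA i : [/\ g i != y, g i \in P & g i i = y i].
  by have:= gA i (mem_enum _ i); rewrite !inE => /and3P[-> -> /eqP].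
have {}g_inj : injective g by move=> i j; apply: g_inj; rewrite mem_enum.
have cX : #|g @: 'I_k| == k by rewrite card_imset ?card_ord.
pose X : ksubset M k := Sub (g @: 'I_k) cX.
exists X; split; first by apply/subsetP=> _ /imsetP[i _ ->]; case: (gA i).
apply/eqP/set0Pn; exists y; rewrite inE Py andbT.
(* [y] is not in [X], since every [g i] differs from [y], and it is the diagonal of the ordering [g]
   of [X]. *)
have [/subsetP-> //] := fP X; rewrite inE; apply/andP; split.
  by apply/imsetP=> -[i _ yE]; case: (gA i); rewrite -yE eqxx.
apply/imsetP; exists (finfun g).
  rewrite inE; apply/andP; split.
    by apply/ffun_onP=> i; rewrite ffunE imset_f.
  by apply/injectiveP=> i j; rewrite !ffunE => /g_inj.
by apply/ffunP=> i; rewrite !ffunE; case: (gA i).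
Qed.
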